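(* Consider the discrete-time time-delay multi-agent system, for $i=1,\dots,N$ and $t\in\mathbb Z^+$, $$x_i(t+1)=A_ix_i(t)+\sum_{l=0}^hB_{il}u_i(t-r_l)+E_{xi}x_0(t)+E_{wi}w_i(t),$$ $$y_{mi}(t)=\bar C_ix_i(t)+\sum_{l=0}^h\bar D_{il}u_i(t-r_l)+\bar F_{xi}x_0(t)+\bar F_{wi}w_i(t),$$ $$e_i(t)=C_ix_i(t)+\sum_{l=0}^hD_{il}u_i(t-r_l)+F_{xi}x_0(t)+F_{wi}w_i(t),$$ with leader $x_0(t+1)=S_0x_0(t)$ and disturbances $w_i(t+1)=Q_iw_i(t)$, together with a digraph $\bar{\mathcal G}$ on the nodes $\{0,1,\dots,N\}$, as described in the context. Assume: (1) For each $i=1,\dots,N$ there exists $K_{1i}\in\mathbb R^{m_i\times n_i}$ such that the system $x_i(t+1)=A_ix_i(t)+\sum_{l=0}^hB_{il}K_{1i}x_i(t-r_l)$ is exponentially stable. (2) For each $i=1,\dots,N$ the pair $\left(\begin{bmatrix}A_i&E_{wi}\\0_{s_i\times n_i}&Q_i\end{bmatrix},\ \begin{bmatrix}\bar C_i&\bar F_{wi}\end{bmatrix}\right)$ is detectable. (3) With $\bar S_i=\begin{bmatrix}S_0&0_{q\times s_i}\\0_{s_i\times q}&Q_i\end{bmatrix}$, $E_i=[E_{xi}\ \ E_{wi}]$, $F_i=[F_{xi}\ \ F_{wi}]$, for each $i=1,\dots,N$ the matrix equations $$X_i\bar S_i^{r+1}=A_iX_i\bar S_i^r+\sum_{l=0}^hB_{il}U_i\bar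 S_i^{r-r_l}+E_i\bar S_i^r,\qquad 0=C_iX_i\bar S_i^r+\sum_{l=0}^hD_{il}U_i\bar S_i^{r-r_l}+F_i\bar S_i^r$$ have a solution pair $X_i\in\mathbb R^{n_i\times(q+s_i)}$, $U_i\in\mathbb R^{m_i\times(q+s_i)}$. (4) The graph $\bar{\mathcal G}$ is time-invariant and every node $i=1,\dots,N$ is reachable from node $0$. If there exists a real number $\mu$ such that the distributed observer error system $$\tilde\eta(t+1)=\big((I_N\otimes S_0)-\mu(H\otimes S_0)\big)\tilde\eta(t)$$ is exponentially stable, then the cooperative output regulation problem for this multi-agent system is solvable by a distributed dynamic output feedback control law; that is, there exists a control law of the form $$u_i(t)=k_i(\zeta_i(t)),$$ $$\zeta_i(t+1)=g_i\big(\zeta_i(t),\zeta_i(t-r_1),\dots,\zeta_i(t-r_h),y_{mi}(t),\ \zeta_j(t),\zeta_j(t-r_1),\dots,\zeta_j(t-r_h),y_{mj}(t),\ j\in\bar{\mathcal N}_i\big),\quad i=1,\dots,N,$$ with $\zeta_i\in\mathbb R^{l_i}$ for some integers $l_i$ and $k_i,g_i$ linear functions, such that: (a) the origin of the closed-loop system is exponentially stable when $x_0=0$ and $w_i=0$, $i=1,\dots,N$; (b) for any initial conditions $x_{00}\in\mathcal C(I[-r,0],\mathbb R^q)$, $x_{i0}\in\mathcal C(I[-r,0],\mathbb R^{n_i})$, $\zeta_{i0}\in\mathcal C(I[-r,0],\mathbb R^{l_i})$, $w_{i0}\in\mathbb R^{s_i}$, $i=1,\dots,N$, the trajectory of the closed-loop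 system satisfies $\lim_{t\to\infty}e_i(t)=0$, $i=1,\dots,N$.
   Context: $\mathbb Z^+$ is the set of nonnegative integers; $I[-r,0]=\{-r,\dots,0\}$; $\mathcal C(I[-r,0],\mathbb R^n)$ is the set of functions from $I[-r,0]$ to $\mathbb R^n$; $\otimes$ is the Kronecker product. Delays are integers $0=r_0<r_1<\cdots<r_h=r<\infty$. $x_i\in\mathbb R^{n_i}$ is the state, $u_i\in\mathbb R^{m_i}$ the input, $e_i\in\mathbb R^{p_i}$ the error output, $y_{mi}\in\mathbb R^{p_{mi}}$ the measurement output, $x_0\in\mathbb R^q$ the measurable exogenous (leader) signal, $w_i\in\mathbb R^{s_i}$ the unmeasurable disturbance. All matrices ($A_i,B_{il},E_{xi},E_{wi},\bar C_i,\bar D_{il},\bar F_{xi},\bar F_{wi},C_i,D_{il},F_{xi},F_{wi},S_0,Q_i$) are constant real of compatible dimensions. A linear delay difference system $x(t+1)=\sum_l M_lx(t-r_l)$ is exponentially stable if there exist $c>0$ and $0<\rho<1$ with $\|x(t)\|\le c\rho^t\max_{\theta\in I[-r,0]}\|x(\theta)\|$ for all $t\in\mathbb Z^+$ and all initial functions on $I[-r,0]$. The digraph $\bar{\mathcal G}=(\bar{\mathcal V},\bar{\mathcal E})$ has $\bar{\mathcal V}=\{0,1,\dots,N\}$, node $0$ being the leader $x_0$ and nodes $1,\dots,N$ the followers; $(i,j)\in\bar{\mathcal E}$ (an edge from $i$ to $j$) if and only if the control $u_j$ can access the measurable output $y_{mi}$ of subsystem $i$, with $y_{m0}=x_0$.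 $\bar{\mathcal N}_i=\{j:(j,i)\in\bar{\mathcal E}\}$ is the neighbor set of $i$. When $0\in\bar{\mathcal N}_i$, the only information from node $0$ in the control law is $y_{m0}=x_0$ (there is no $\zeta_0$). Node $i_{k+1}$ is reachable from $i_1$ if there are edges $(i_1,i_2),\dots,(i_k,i_{k+1})$ in $\bar{\mathcal E}$. A weighted adjacency matrix $[a_{ij}]\in\mathbb R^{(N+1)\times(N+1)}$, $i,j=0,\dots,N$, satisfies $a_{ii}=0$, and, for $i\neq j$, $a_{ij}>0$ if $(j,i)\in\bar{\mathcal E}$ and $a_{ij}=0$ otherwise. $H=[h_{ij}]\in\mathbb R^{N\times N}$, $i,j=1,\dots,N$, has $h_{ii}=\sum_{j=0}^Na_{ij}$ and $h_{ij}=-a_{ij}$ for $i\ne j$. The distributed observer is $\eta_i(t+1)=S_0\eta_i(t)+\mu S_0\sum_{j\in\bar{\mathcal N}_i}a_{ij}(\eta_j(t)-\eta_i(t))$, $i=1,\dots,N$, $\eta_0=x_0$; its error $\tilde\eta=\mathrm{col}(\eta_1-x_0,\dots,\eta_N-x_0)$ (vertical stacking) obeys the error system in the claim. *)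

(* Defs.v *)
From HB Require Import structures.
From mathcomp Require Export all_boot all_order all_algebra.
From mathcomp Require Export all_classical all_reals all_analysis.
From mathcomp Require Export complex mxtens.

Set Implicit Arguments.
Unset Strict Implicit.
Unset Printing Implicit Defensive.

Export Order.TTheory GRing.Theory Num.Theory.
Export numFieldNormedType.Exports.

Local Open Scope classical_set_scope.
Local Open Scope ring_scope.

(* Signals are functions on int.  A signal with an initial function on
   {-r, ..., 0} is only ever used at times t >= -r; its values before -r are
   unconstrained junk that occurs in no equation and in no bound.  In the
   system equations t : nat is the current time and is coerced to int. *)

(* The norm on 'cV[R]_n is the library's (maximum) norm; since all norms on R^n
   are equivalent, the constant c absorbs the choice.  The system is given as
   the set of its trajectories, r being its maximal delay. *)
Definition exp_stable (R : realType) (n r : nat)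
    (sys : (int -> 'cV[R]_n) -> Prop) : Prop :=
  exists c rho : R, [/\ 0 < c, 0 < rho < 1 &
    forall x, sys x -> forall t : nat,
      `|x t| <= c * rho ^+ t * \big[Num.max/0]_(k < r.+1) `|x (- k%:Z)|].

Definition schur (R : realType) (n : nat) (A : 'M[R]_n) : Prop :=
  forall z : complex R, eigenvalue (map_mx (real_complex R) A) z -> `|z| < 1.

Definition detectable (R : realType) (n p : nat)
    (A : 'M[R]_n) (C : 'M[R]_(p, n)) : Prop :=
  exists L : 'M[R]_(n, p), schur (A - L *m C).

Definition delays (h : nat) (rd : 'I_h.+1 -> nat) : Prop :=
  rd ord0 = 0%N /\ forall l k : 'I_h.+1, (l < k)%N -> (rd l < rd k)%N.

(* Follower i : 'I_N is node lift ord0 i of the graph; node ord0 is the leader.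
   E j i means that (j, i) is an edge. *)
Definition node (N : nat) (i : 'I_N) : 'I_N.+1 := lift ord0 i.

Definition weighted_adjacency (R : realType) (N : nat) (E : rel 'I_N.+1)
    (a : 'M[R]_N.+1) : Prop :=
  (forall i, a i i = 0) /\
  (forall i j, i != j -> if E j i then (0 < a i j : Prop) else a i j = 0).

Definition Hmx (R : realType) (N : nat) (a : 'M[R]_N.+1) : 'M[R]_N :=
  \matrix_(i, j) if i == j then \sum_(k < N.+1) a (node i) k
                 else - a (node i) (node j).

(* Dimensions and matrices of one follower; h + 1 is the number of input
   delays and q the dimension of the leader signal.  Cm, Dm, Fxm and Fwm are
   the barred matrices of the measurement output. *)
Record subsystem (R : realType) (h q : nat) := Subsystem {
  dimx : nat; dimu : nat; dime : nat; dimm : nat; dimw : nat;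
  Amx : 'M[R]_dimx;
  Bmx : 'I_h.+1 -> 'M[R]_(dimx, dimu);
  Exmx : 'M[R]_(dimx, q);
  Ewmx : 'M[R]_(dimx, dimw);
  Cm : 'M[R]_(dimm, dimx);
  Dm : 'I_h.+1 -> 'M[R]_(dimm, dimu);
  Fxm : 'M[R]_(dimm, q);
  Fwm : 'M[R]_(dimm, dimw);
  Cmx : 'M[R]_(dime, dimx);
  Dmx : 'I_h.+1 -> 'M[R]_(dime, dimu);
  Fxmx : 'M[R]_(dime, q);
  Fwmx : 'M[R]_(dime, dimw);
  Qmx : 'M[R]_dimw }.

Section Subsystem.
Variables (R : realType) (h q : nat) (rd : 'I_h.+1 -> nat).
Variable P : subsystem R h q.
Variables (x : int -> 'cV[R]_(dimx P)) (u : int -> 'cV[R]_(dimu P)).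
Variables (x0 : int -> 'cV[R]_q) (w : nat -> 'cV[R]_(dimw P)).

Definition state_eq : Prop := forall t : nat,
  x t.+1 = Amx P *m x t + \sum_(l < h.+1) Bmx P l *m u (t%:Z - (rd l)%:Z)
           + Exmx P *m x0 t + Ewmx P *m w t.

Definition measurement (t : nat) : 'cV[R]_(dimm P) :=
  Cm P *m x t + \sum_(l < h.+1) Dm P l *m u (t%:Z - (rd l)%:Z)
  + Fxm P *m x0 t + Fwm P *m w t.

Definition error_output (t : nat) : 'cV[R]_(dime P) :=
  Cmx P *m x t + \sum_(l < h.+1) Dmx P l *m u (t%:Z - (rd l)%:Z)
  + Fxmx P *m x0 t + Fwmx P *m w t.
End Subsystem.

Definition stabilizable_by_delayed_feedback (R : realType) (h q : nat)
    (rd : 'I_h.+1 -> nat) (P : subsystem R h q) : Prop :=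
  exists K : 'M[R]_(dimu P, dimx P),
    exp_stable (rd ord_max) (fun x : int -> 'cV[R]_(dimx P) =>
      forall t : nat, x t.+1 = Amx P *m x t
        + \sum_(l < h.+1) Bmx P l *m K *m x (t%:Z - (rd l)%:Z)).

Definition regulator_solvable (R : realType) (h q : nat)
    (rd : 'I_h.+1 -> nat) (S0 : 'M[R]_q) (P : subsystem R h q) : Prop :=
  let r := rd ord_max in
  let S := block_mx S0 0 0 (Qmx P) in
  exists (X : 'M[R]_(dimx P, q + dimw P)) (U : 'M[R]_(dimu P, q + dimw P)),
    X *m S ^+ r.+1 = Amx P *m X *m S ^+ r
      + \sum_(l < h.+1) Bmx P l *m U *m S ^+ (r - rd l)
      + row_mx (Exmx P) (Ewmx P) *m S ^+ r
    /\
    0 = Cmx P *m X *m S ^+ r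
      + \sum_(l < h.+1) Dmx P l *m U *m S ^+ (r - rd l)
      + row_mx (Fxmx P) (Fwmx P) *m S ^+ r.

(* A linear map of several vector arguments is a sum of matrices applied to the
   arguments.  So kmx i is the matrix of k_i, and g_i has the matrix
   gz i j l for the argument zeta_j(t - r_l), gy i j for y_mj(t) and gx0 i for
   y_m0(t) = x_0(t).  Only the matrices whose argument is available to agent i
   are used, see controller_next. *)
Record control_law (R : realType) (N h q : nat)
    (P : 'I_N -> subsystem R h q) := ControlLaw {
  dimz : 'I_N -> nat;
  kmx : forall i, 'M[R]_(dimu (P i), dimz i);
  gz : forall i j, 'I_h.+1 -> 'M[R]_(dimz i, dimz j);
  gy : forall i j, 'M[R]_(dimz i, dimm (P j));
  gx0 : forall i, 'M[R]_(dimz i, q) }.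

Section ClosedLoop.
Variables (R : realType) (N h q : nat) (rd : 'I_h.+1 -> nat).
Variables (E : rel 'I_N.+1) (P : 'I_N -> subsystem R h q).
Variable law : control_law P.

Section Trajectory.
Variables (x0 : int -> 'cV[R]_q) (w : forall i, nat -> 'cV[R]_(dimw (P i))).
Variables (x : forall i, int -> 'cV[R]_(dimx (P i))).
Variables (z : forall i, int -> 'cV[R]_(dimz law i)).

Definition input i (t : int) : 'cV[R]_(dimu (P i)) := kmx law i *m z i t.

Definition controller_next i (t : nat) : 'cV[R]_(dimz law i) :=
  \sum_(j < N | (j == i) || E (node j) (node i))
     (\sum_(l < h.+1) gz law i j l *m z j (t%:Z - (rd l)%:Z)
      + gy law i j *m measurement rd (x j) (input j) x0 (w j) t)
  + (if E ord0 (node i) then gx0 law i *m x0 t else 0).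

Definition closed_loop : Prop := forall i,
  state_eq rd (x i) (input i) x0 (w i) /\
  (forall t : nat, z i t.+1 = controller_next i t).
End Trajectory.

(* The state of the closed-loop system stacks all x_i and all zeta_i. *)
Definition closed_loop_state (x : forall i, int -> 'cV[R]_(dimx (P i)))
    (z : forall i, int -> 'cV[R]_(dimz law i)) (t : int) :
    'cV[R]_(\sum_i dimx (P i) + \sum_i dimz law i) :=
  col_mx (\mxcol_i x i t) (\mxcol_i z i t).

Definition closed_loop_exp_stable : Prop :=
  exp_stable (rd ord_max) (fun s => exists x z,
    closed_loop (fun=> 0) (fun i => fun=> 0) x z /\
    s = closed_loop_state x z).

Definition exosystem (S0 : 'M[R]_q) (x0 : int -> 'cV[R]_q)
    (w : forall i, nat -> 'cV[R]_(dimw (P i))) : Prop :=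
  (forall t : nat, x0 t.+1 = S0 *m x0 t) /\
  (forall i (t : nat), w i t.+1 = Qmx (P i) *m w i t).

(* Quantifying over all trajectories amounts to quantifying over all initial
   functions, each of which determines its trajectory. *)
Definition error_regulation (S0 : 'M[R]_q) : Prop :=
  forall x0 w x z, exosystem S0 x0 w -> closed_loop x0 w x z ->
  forall i, error_output rd (x i) (input z i) x0 (w i) t @[t --> \oo]
            --> (0 : 'cV[R]_(dime (P i))).
End ClosedLoop.

Definition cooperative_output_regulation_solvable (R : realType) (N h q : nat)
    (rd : 'I_h.+1 -> nat) (E : rel 'I_N.+1) (S0 : 'M[R]_q)
    (P : 'I_N -> subsystem R h q) : Prop :=
  exists law : control_law P,
    closed_loop_exp_stable rd E law /\ error_regulation rd E law S0.

(* Main.v *)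
Require Import Defs.
From mathcomp Require Import ring lra zify.

(* Each agent runs the distributed observer, giving eta_i, and a Luenberger
   observer of (x_i, w_i) in which eta_i replaces the unavailable x_0; the
   input is u_i = K_i xhat_i + (U_i - K_i X_i) (eta_i, what_i).  The errors form a
   cascade: eta_i - x_0 is autonomous and exponentially stable, it drives the
   estimation error of (x_i, w_i), whose matrix is Schur, and both drive the
   delayed system closed by K_i.  Variation of constants shows that an
   exponentially stable linear delay system with exponentially decaying forcing
   decays exponentially, so the closed loop is exponentially stable.  For
   regulation, v = (x_0, w_i) satisfies v(s + k) = S^k v(s), so that the regulator
   equations multiplied by v(s) say that (X_i v, U_i v) solves the plant equations
   with zero error from time r on; the deviation of (x_i, u_i) from it obeys the
   same stable delayed system. *)

Set Implicit Arguments.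
Unset Strict Implicit.
Unset Printing Implicit Defensive.

Local Open Scope classical_set_scope.
Local Open Scope ring_scope.

(** * Matrix norms and exponential decay *)

Section MatrixNorm.
Variable R : realType.

Lemma mx_norm_le m n (A : 'M[R]_(m, n)) (b : R) :
  0 <= b -> (forall i j, `|A i j| <= b) -> `|A| <= b.
Proof.
move=> b0 Ab; rewrite [leLHS]/Num.Def.normr /= mx_normrE.
by apply: bigmax_le => // -[i j] _; exact: Ab.
Qed.

Lemma mx_entry_le m n (A : 'M[R]_(m, n)) i j : `|A i j| <= `|A|.
Proof.
rewrite [leRHS]/Num.Def.normr /= mx_normrE.
by apply/bigmax_geP; right => /=; exists (i, j).
Qed.

(** A crude stand-in for the operator norm: all that matters is that it is a finite bound depending
    on [A] alone. *)
Definition mx_abs_sum m n (A : 'M[R]_(m, n)) : R := \sum_i \sum_j `|A i j|.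

Lemma mx_abs_sum_ge0 m n (A : 'M[R]_(m, n)) : 0 <= mx_abs_sum A.
Proof. by apply: sumr_ge0 => i _; apply: sumr_ge0. Qed.

Lemma mulmx_norm m n p (A : 'M[R]_(m, n)) (B : 'M[R]_(n, p)) :
  `|A *m B| <= mx_abs_sum A * `|B|.
Proof.
apply: mx_norm_le => [|i j]; first by rewrite mulr_ge0 ?mx_abs_sum_ge0.
rewrite mxE (le_trans (ler_norm_sum _ _ _)) //.
apply: (@le_trans _ _ ((\sum_k `|A i k|) * `|B|)).
  rewrite mulr_suml; apply: ler_sum => k _.
  by rewrite normrM ler_wpM2l // mx_entry_le.
rewrite ler_wpM2r // /mx_abs_sum (bigD1 i) //= lerDl.
by apply: sumr_ge0 => k _; apply: sumr_ge0.
Qed.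

Lemma col_mx_norm m n p (A : 'M[R]_(m, p)) (B : 'M[R]_(n, p)) :
  `|col_mx A B| <= `|A| + `|B|.
Proof.
apply: mx_norm_le => [|i j]; first by rewrite addr_ge0.
rewrite mxE; case: (fintype.split i) => k.
  by rewrite (le_trans (mx_entry_le _ _ _)) // lerDl.
by rewrite (le_trans (mx_entry_le _ _ _)) // lerDr.
Qed.

Lemma usubmx_norm m n p (A : 'M[R]_(m + n, p)) : `|usubmx A| <= `|A|.
Proof. by apply: mx_norm_le => // i j; rewrite mxE mx_entry_le. Qed.

Lemma dsubmx_norm m n p (A : 'M[R]_(m + n, p)) : `|dsubmx A| <= `|A|.
Proof. by apply: mx_norm_le => // i j; rewrite mxE mx_entry_le. Qed.

Lemma mxcol_norm N p (d : 'I_N -> nat) (A : forall i, 'M[R]_(d i, p)) :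
  `|\mxcol_i A i| <= \sum_i `|A i|.
Proof.
apply: mx_norm_le => [|i j]; first exact: sumr_ge0.
rewrite mxE (le_trans (mx_entry_le _ _ _)) // [leRHS](bigD1 (tagnat.sig1 i)) //= lerDl.
exact: sumr_ge0.
Qed.

Lemma mxcol_norm_ge N p (d : 'I_N -> nat) (A : forall i, 'M[R]_(d i, p)) i :
  `|A i| <= `|\mxcol_i A i|.
Proof.
have {1}<- : submxcol (\mxcol_i A i) i = A i := mxcolK A i.
by apply: mx_norm_le => // k j; rewrite mxE mx_entry_le.
Qed.

End MatrixNorm.

(** * Scalar recursions with geometric forcing *)

Section GeometricRecursion.
Variables (F : numFieldType) (a rho : F).
Hypotheses (a_ge0 : 0 <= a) (a_lt1 : a < 1) (rho_01 : 0 < rho < 1).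

(* A common rate for a and rho, defined without comparing them: F may be the
   field of complex numbers. *)
Definition rate_join : F := 1 - (1 - a) * (1 - rho).

Lemma rate_join_01 : 0 < rate_join < 1.
Proof.
case/andP: rho_01 => r0 r1; apply/andP; split; last first.
  by rewrite ltrBlDr ltrDl mulr_gt0 // subr_gt0.
have -> : rate_join = a * (1 - rho) + rho by rewrite /rate_join; ring.
by rewrite ltr_wpDl // mulr_ge0 // subr_ge0 ltW.
Qed.

Lemma rate_join_ger : rho <= rate_join.
Proof.
case/andP: rho_01 => r0 r1.
have -> : rate_join = a * (1 - rho) + rho by rewrite /rate_join; ring.
by rewrite lerDr mulr_ge0 // subr_ge0 ltW.
Qed.

Lemma rate_join_gel : a <= rate_join.
Proof.
case/andP: rho_01 => r0 r1.
have -> : rate_join = a + (1 - a) * rho by rewrite /rate_join; ring.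
by rewrite lerDl mulr_ge0 ?(ltW r0) // subr_ge0 ltW.
Qed.

(** The joint rate [s] equals [a + (1 - a) * rho], so [K * s ^+ t] reproduces itself under the
    recursion as soon as [K * ((1 - a) * rho)] dominates [c]; this dictates the second term of the
    constant, and the first covers time 0. *)
Lemma geometric_recursion (y : nat -> F) (c : F) :
  0 <= c -> 0 <= y 0%N -> (forall t, y t.+1 <= a * y t + c * rho ^+ t) ->
  forall t, y t <= (y 0%N + c / ((1 - a) * rho)) * rate_join ^+ t.
Proof.
move=> c0 y0 yS; case/andP: rho_01 => r0 r1.
have d0 : 0 < (1 - a) * rho by rewrite mulr_gt0 // subr_gt0.
set K := _ + _.
have K0 : 0 <= K by rewrite addr_ge0 // divr_ge0 // ltW.
have s0 : 0 < rate_join by case/andP: rate_join_01.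
elim=> [|t IH]; first by rewrite expr0 mulr1 lerDl divr_ge0 // ltW.
apply: (le_trans (yS t)).
have -> : K * rate_join ^+ t.+1
    = a * (K * rate_join ^+ t) + (K * ((1 - a) * rho)) * rate_join ^+ t.
  by rewrite exprS {1}/rate_join; ring.
apply: lerD; first exact: ler_wpM2l.
apply: ler_pM => //; first by rewrite exprn_ge0 // ltW.
  rewrite mulrDl divfK ?gt_eqF // lerDr mulr_ge0 //; exact: ltW.
by apply: lerXn2r; rewrite ?nnegrE ?rate_join_ger // ltW.
Qed.

End GeometricRecursion.

(** * Exponential decay, uniform over a family of trajectories *)

Section ExpDecay.
Variables (R : realType) (T : Type).

(* One pair (c, rho) serves all trajectories x of the family T; g x measures the
   initial data of x. *)
Definition exp_decay (g : T -> R) (f : T -> nat -> R) : Prop :=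
  exists c rho : R, [/\ 0 < c, 0 < rho < 1 &
    forall x t, f x t <= c * rho ^+ t * g x].

Variable g : T -> R.
Hypothesis g_ge0 : forall x, 0 <= g x.

Lemma exp_decay_le f f' :
  (forall x t, f x t <= f' x t) -> exp_decay g f' -> exp_decay g f.
Proof.
by move=> ff' [c [rho [c0 r01 H]]]; exists c, rho; split=> // x t;
  exact: le_trans (ff' x t) (H x t).
Qed.

Lemma exp_decay_cst0 : exp_decay g (fun _ _ => 0).
Proof.
exists 1, 2^-1; split; [by []|by apply/andP; split; lra|move=> x t].
by rewrite mul1r mulr_ge0 // exprn_ge0 // invr_ge0.
Qed.

Lemma exp_decayD f f' : exp_decay g f -> exp_decay g f' ->
  exp_decay g (fun x t => f x t + f' x t).
Proof.
move=> [c [rho [c0 /andP[r0 r1] H]]] [c' [rho' [c'0 r01' H']]].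
have [s0 _] := andP (rate_join_01 (ltW r0) r1 r01').
exists (c + c'), (rate_join rho rho'); split=> [||x t].
- exact: addr_gt0.
- exact: rate_join_01 (ltW r0) r1 r01'.
rewrite !mulrDl; apply: lerD.
  apply: le_trans (H x t) _; rewrite ler_wpM2r // ler_wpM2l //; first exact: ltW.
  by apply: lerXn2r; rewrite ?nnegrE ?rate_join_gel // ltW.
apply: le_trans (H' x t) _; rewrite ler_wpM2r // ler_wpM2l //; first exact: ltW.
apply: lerXn2r; rewrite ?nnegrE ?rate_join_ger ?(ltW r0) ?(ltW s0) //.
by case/andP: r01' => /ltW.
Qed.

Lemma exp_decayZ k f : 0 <= k -> exp_decay g f ->
  exp_decay g (fun x t => k * f x t).
Proof.
move=> k0 [c [rho [c0 r01 H]]]; exists ((k + 1) * c), rho.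
have cr t : 0 <= c * rho ^+ t by case/andP: r01 => /ltW r0 _; rewrite mulr_ge0 ?exprn_ge0 // ltW.
split=> // [|x t]; first by rewrite mulr_gt0 // ltr_wpDl.
rewrite (le_trans (ler_wpM2l k0 (H x t))) // -!mulrA.
by rewrite ler_wpM2r ?lerDl // mulrA mulr_ge0.
Qed.

Lemma exp_decay_sum (I : Type) (s : seq I) (f : I -> T -> nat -> R) :
  (forall i, exp_decay g (f i)) ->
  exp_decay g (fun x t => \sum_(i <- s) f i x t).
Proof.
move=> H; elim: s => [|i s IH].
  by apply: exp_decay_le exp_decay_cst0 => x t; rewrite big_nil.
by apply: exp_decay_le (exp_decayD (H i) IH) => x t; rewrite big_cons.
Qed.

Lemma exp_decay_mulmx m n p (A : 'M[R]_(m, n)) (f : T -> nat -> 'M[R]_(n, p)) :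
  exp_decay g (fun x t => `|f x t|) -> exp_decay g (fun x t => `|A *m f x t|).
Proof.
move=> H; apply: exp_decay_le (exp_decayZ (mx_abs_sum_ge0 A) H) => x t.
exact: mulmx_norm.
Qed.

Lemma exp_decay_normD m n (f f' : T -> nat -> 'M[R]_(m, n)) :
  exp_decay g (fun x t => `|f x t|) -> exp_decay g (fun x t => `|f' x t|) ->
  exp_decay g (fun x t => `|f x t + f' x t|).
Proof.
move=> H H'; apply: exp_decay_le (exp_decayD H H') => x t; exact: ler_normD.
Qed.

Lemma exp_decay_norm_sum (I : Type) (s : seq I) m n
    (f : I -> T -> nat -> 'M[R]_(m, n)) :
  (forall i, exp_decay g (fun x t => `|f i x t|)) ->
  exp_decay g (fun x t => `|\sum_(i <- s) f i x t|).
Proof.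
move=> H; apply: exp_decay_le (exp_decay_sum s H) => x t; exact: ler_norm_sum.
Qed.

Lemma exp_decay_shift k f : exp_decay g f ->
  exp_decay g (fun x t => f x (t + k)%N).
Proof.
move=> [c [rho [c0 /andP[r0 r1] H]]].
exists c, rho; rewrite r0 r1; split=> // x t.
apply: (le_trans (H _ _)); rewrite exprD !mulrA ler_wpM2r //.
rewrite ler_piMr ?exprn_ile1 ?(ltW r0) ?(ltW r1) //.
by rewrite mulr_ge0 ?exprn_ge0 ?(ltW r0) ?(ltW c0).
Qed.

(** A delayed time may fall into the initial window, where only the bound by [b * g x] is available.
    Dividing by [rho ^+ k] pays for both cases: it undoes the delay when [k <= t], and makes the
    factor [rho ^+ t / rho ^+ k] at least 1 when [t < k]. *)
Lemma exp_decay_history m n (b : R) (r k : nat) (f : T -> int -> 'M[R]_(m, n)) :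
  0 < b -> (forall x j, (j <= r)%N -> `|f x (- j%:Z)| <= b * g x) -> (k <= r)%N ->
  exp_decay g (fun x t => `|f x t|) ->
  exp_decay g (fun x t => `|f x (t%:Z - k%:Z)|).
Proof.
move=> b0 init kr [c [rho [c0 /andP[r0 r1] H]]].
have rk : 0 < rho ^+ k by rewrite exprn_gt0.
exists ((c + b) / rho ^+ k), rho; rewrite r0 r1; split=> // [|x t].
  by rewrite divr_gt0 ?addr_gt0.
have -> : (c + b) / rho ^+ k * rho ^+ t * g x =
  (c + b) * g x * (rho ^+ t / rho ^+ k) by ring.
have [kt|tk] := leqP k t.
  have -> : t%:Z - k%:Z = (t - k)%N by lia.
  apply: le_trans (H _ _) _.
  rewrite -[in leRHS](subnK kt) exprD mulfK ?gt_eqF // mulrAC.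
  rewrite !mulrDl lerDl mulr_ge0 ?exprn_ge0 ?(ltW r0) //.
  by rewrite mulr_ge0 // ltW.
have -> : t%:Z - k%:Z = - (k - t)%N%:Z by lia.
apply: le_trans (init _ _ _) _; first by lia.
apply: (@le_trans _ _ ((c + b) * g x)).
  by rewrite mulrDl lerDr mulr_ge0 // ltW.
rewrite ler_peMr ?mulr_ge0 ?addr_ge0 ?(ltW c0) ?(ltW b0) //.
rewrite ler_pdivlMr // mul1r.
exact: (ler_wiXn2l (ltW r0) (ltW r1) (ltnW tk)).
Qed.

Lemma exp_decay_cvg0 f x : (forall t, 0 <= f x t) -> exp_decay g f ->
  f x t @[t --> \oo] --> (0 : R).
Proof.
move=> f0 [c [rho [c0 /andP[r0 r1] H]]].
apply: (@squeeze_cvgr _ _ _ _ (fun=> 0) (fun t => c * g x * rho ^+ t)).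
- by apply: nearW => t; rewrite f0 /= mulrAC H.
- exact: cvg_cst.
rewrite -[X in _ --> X](mulr0 (c * g x)).
apply: cvgM; first exact: cvg_cst.
by apply: cvg_expr; rewrite gtr0_norm.
Qed.

End ExpDecay.

(** * Forced linear delay systems *)

Section DelaySystem.
Variables (R : realType) (n h : nat) (A : 'M[R]_n) (M : 'I_h -> 'M[R]_n).
Variable rd : 'I_h -> nat.

Definition delay_system (x : int -> 'cV[R]_n) : Prop := forall t : nat,
  x t.+1 = A *m x t + \sum_l M l *m x (t%:Z - (rd l)%:Z).

(** The recursion carries the whole past, [k] being the distance back from [t], because the delays
    are arbitrary and the value at [t - rd l] is not structurally available otherwise. *)
Fixpoint fundamental_history (t : nat) : nat -> 'M[R]_n :=
  if t is t'.+1 then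
    fun k => if k is k'.+1 then fundamental_history t' k' else
      A *m fundamental_history t' 0
      + \sum_l M l *m fundamental_history t' (rd l)
  else fun k => if k is 0 then 1%:M else 0.

(** The fundamental matrix solution: identity at time 0, zero before. *)
Definition fundamental (t : int) : 'M[R]_n :=
  if t is Posz t' then fundamental_history t' 0 else 0.

Lemma fundamental_historyE t k :
  fundamental_history t k = fundamental (t%:Z - k%:Z).
Proof.
elim: t k => [|t IH] [|k]; rewrite ?subr0 //.
by rewrite /= IH; congr fundamental; lia.
Qed.

Lemma fundamental_neg t : t < 0 -> fundamental t = 0.
Proof. by case: t. Qed.

Lemma fundamentalS (t : nat) : fundamental t.+1 =
  A *m fundamental t + \sum_l M l *m fundamental (t%:Z - (rd l)%:Z).
Proof. by rewrite /=; congr (_ + _); apply: eq_bigr => l _; rewrite fundamental_historyE. Qed.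

Lemma fundamental_delay_system (v : 'cV[R]_n) :
  delay_system (fun t => fundamental t *m v).
Proof.
move=> t; rewrite fundamentalS mulmxDl mulmxA mulmx_suml.
by congr (_ + _); apply: eq_bigr => l _; rewrite mulmxA.
Qed.

(** The discrete convolution of the forcing with the fundamental solution, that is, the forced
    solution with zero initial function. *)
Definition forced_response (f : nat -> 'cV[R]_n) (t : int) : 'cV[R]_n :=
  if t is Posz t' then \sum_(s < t') fundamental (t'%:Z - s.+1%:Z) *m f s else 0.

(** The extra terms vanish because [fundamental] is zero at negative times. With a common range of
    summation for all delays, the sums over delays and over past forcing can be exchanged. *)
Lemma forced_response_widen f (t : int) (k : nat) : t <= k%:Z ->
  forced_response f t = \sum_(s < k) fundamental (t - s.+1%:Z) *m f s.
Proof.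
case: t => [t|t] tk; last first.
  rewrite [RHS]big1 // => s _; rewrite fundamental_neg ?mul0mx //; lia.
rewrite [LHS](big_ord_widen _ (fun s => fundamental (t%:Z - s.+1%:Z) *m f s) tk).
rewrite big_mkcond; apply: eq_bigr => s _; case: ifPn => // st.
rewrite fundamental_neg ?mul0mx //; lia.
Qed.

Lemma forced_responseS f (t : nat) : forced_response f t.+1 =
  A *m forced_response f t
  + \sum_l M l *m forced_response f (t%:Z - (rd l)%:Z) + f t.
Proof.
rewrite /= big_ord_recr /= subrr mul1mx; congr (_ + _).
under [X in _ + X]eq_bigr => l _.
  rewrite (@forced_response_widen f _ t); last by lia.
  rewrite mulmx_sumr; over.
rewrite exchange_big mulmx_sumr -big_split /=; apply: eq_bigr => s _.
have -> : t.+1%:Z - s.+1%:Z = (t - s.+1).+1%:Z by have := ltn_ord s; lia.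
rewrite fundamentalS mulmxDl mulmx_suml mulmxA.
have -> : (t - s.+1)%:Z = t%:Z - s.+1%:Z by have := ltn_ord s; lia.
congr (_ + _); apply: eq_bigr => l _.
by rewrite mulmxA; congr (_ *m fundamental _ *m _); lia.
Qed.

Lemma forced_response_le0 f t : t <= 0 -> forced_response f t = 0.
Proof. by case: t => [[|t]|t] //= _; rewrite big_ord0. Qed.

(** Variation of constants: subtracting [forced_response] leaves a solution of the homogeneous
    system, bounded by stability, while the response itself is bounded by the convolution of two
    geometric sequences. *)
Lemma exp_stable_forced (r : nat) (T : Type) (g : T -> R)
    (b : R) (x : T -> int -> 'cV[R]_n) (f : T -> nat -> 'cV[R]_n) :
  exp_stable r delay_system ->
  (forall w, 0 <= g w) -> 0 < b ->
  (forall w (t : nat), x w t.+1 =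
     A *m x w t + \sum_l M l *m x w (t%:Z - (rd l)%:Z) + f w t) ->
  (forall w (k : nat), (k <= r)%N -> `|x w (- k%:Z)| <= b * g w) ->
  exp_decay g (fun w t => `|f w t|) ->
  exp_decay g (fun w t => `|x w t|).
Proof.
move=> [c [rho [c0 r01 stab]]] g0 b0 xS xg [d [lam [d0 l01 fd]]].
have [r0 r1] := andP r01; have [l0 l1] := andP l01.
(* The initial window of [fundamental t *m v] is [v] at time 0 and zero elsewhere, so its maximum is
   the norm of [v]. *)
have fund (v : 'cV[R]_n) (t : nat) :
    `|fundamental t *m v| <= c * rho ^+ t * `|v|.
  apply: le_trans (stab _ (fundamental_delay_system v) t) _.
  rewrite ler_wpM2l ?mulr_ge0 ?exprn_ge0 ?(ltW c0) ?(ltW r0) //.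
  apply: bigmax_le => // -[[|k] kr] _ /=.
    by rewrite mul1mx.
  by rewrite mul0mx normr0.
(* The convolution satisfies a first-order recursion with multiplier [rho] and forcing [lam ^+ t],
   hence decays at the joint rate even if [rho = lam]. *)
pose conv (t : nat) : R := \sum_(s < t) rho ^+ (t - s.+1) * lam ^+ s.
have convS t : conv t.+1 = rho * conv t + 1 * lam ^+ t.
  rewrite /conv big_ord_recr /= subnn expr0 mulr_sumr; congr (_ + _).
  apply: eq_bigr => s _; rewrite mulrA -exprS; congr (_ ^+ _ * _).
  by have := ltn_ord s; lia.
have conv0 : conv 0%N = 0 by rewrite /conv big_ord0.
have conv_le t : conv t <= ((1 - rho) * lam)^-1 * rate_join rho lam ^+ t.
  have := @geometric_recursion R rho lam (ltW r0) r1 l01 conv 1 ler01.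
  rewrite conv0 add0r mul1r; apply=> // s.
  by rewrite convS.
have forced w : forall t : nat, `|forced_response (f w) t| <= c * d * g w * conv t.
  move=> t /=; apply: le_trans (ler_norm_sum _ _ _) _.
  rewrite mulr_sumr; apply: ler_sum => s _.
  have -> : t%:Z - s.+1%:Z = (t - s.+1)%:Z by have := ltn_ord s; lia.
  apply: le_trans (fund _ _) _.
  have -> : c * d * g w * (rho ^+ (t - s.+1) * lam ^+ s) =
    c * rho ^+ (t - s.+1) * (d * lam ^+ s * g w) by ring.
  by rewrite ler_wpM2l ?mulr_ge0 ?exprn_ge0 ?(ltW c0) ?(ltW r0).
have decomp w t : x w t = (x w t - forced_response (f w) t)
    + forced_response (f w) t by rewrite subrK.
have free : exp_decay g (fun w t => `|x w t - forced_response (f w) t|).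
  exists (c * b), rho; split=> // [|w t]; first exact: mulr_gt0.
  have sys : delay_system (fun t => x w t - forced_response (f w) t).
    move=> s; rewrite xS forced_responseS opprD addrACA subrr addr0 opprD addrACA mulmxBr.
    by congr (_ + _); rewrite -sumrB; apply: eq_bigr => l _; rewrite mulmxBr.
  apply: le_trans (stab _ sys t) _.
  rewrite [leRHS](_ : _ = c * rho ^+ t * (b * g w)); last by ring.
  rewrite ler_wpM2l ?mulr_ge0 ?exprn_ge0 ?(ltW c0) ?(ltW r0) //.
  apply: bigmax_le => [|k _]; first by rewrite mulr_ge0 // ltW.
  (* The response vanishes up to time 0, so the subtraction does not change the initial window. *)
  rewrite forced_response_le0 ?subr0; last by lia.
  by apply: xg; rewrite -ltnS.
have [s0 s1] := andP (rate_join_01 (ltW r0) r1 l01).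
apply: exp_decay_le (exp_decayD g0 free _); last first.
  exists (c * d * ((1 - rho) * lam)^-1), (rate_join rho lam); split.
  - by rewrite !mulr_gt0 // invr_gt0 mulr_gt0 // subr_gt0.
  - by rewrite s0.
  move=> w t; apply: le_trans (forced w t) _.
  set K := _^-1; rewrite [leRHS](_ : _ = c * d * g w * (K * rate_join rho lam ^+ t)); last by ring.
  by rewrite ler_wpM2l // !mulr_ge0 ?(ltW c0) ?(ltW d0).
by move=> w t /=; rewrite {1}decomp ler_normD.
Qed.

End DelaySystem.

(** * Schur matrices *)

Section PowersBound.
Variables (F : numFieldType) (n : nat) (A : 'M[F]_n.+1).

(** The right factor [B] lets the linear factors of an annihilating polynomial be peeled off one at
    a time; the field is general so that complex eigenvalues are allowed. *)
Definition powers_decay (B : 'M[F]_n.+1) : Prop := exists c rho : F,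
  [/\ 0 < c, 0 < rho < 1 & forall t i j, `|(A ^+ t *m B) i j| <= c * rho ^+ t].

(** Since [A ^+ t.+1 *m B] is [z] times [A ^+ t *m B] plus [A ^+ t *m ((A - z%:M) *m B)], each entry
    obeys a scalar recursion with multiplier [|z|] and geometrically decaying forcing. *)
Lemma powers_decay_step (B : 'M[F]_n.+1) (z : F) :
  `|z| < 1 -> powers_decay ((A - z%:M) *m B) -> powers_decay B.
Proof.
move=> z1 [c [rho [c0 r01 H]]].
have [s0 s1] := andP (rate_join_01 (normr_ge0 z) z1 r01).
have [r0 r1] := andP r01.
pose b := \sum_i \sum_j `|B i j|; pose d := c / ((1 - `|z|) * rho).
have b0 : 0 <= b by apply: sumr_ge0 => i _; apply: sumr_ge0.
have d0 : 0 < d by rewrite divr_gt0 // mulr_gt0 // subr_gt0.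
exists (b + d), (rate_join `|z| rho); split; rewrite ?s0 ?ltr_wpDl // => t i j.
have step s : `|(A ^+ s.+1 *m B) i j|
    <= `|z| * `|(A ^+ s *m B) i j| + c * rho ^+ s.
  have -> : A ^+ s.+1 *m B = z *: (A ^+ s *m B) + A ^+ s *m ((A - z%:M) *m B).
    rewrite mulmxBl mul_scalar_mx mulmxBr -scalemxAr addrC subrK.
    by rewrite exprSr -mulmxE mulmxA.
  by rewrite mxE (le_trans (ler_normD _ _)) // mxE normrM lerD2l H.
have := geometric_recursion (normr_ge0 z) z1 r01 (ltW c0)
  (normr_ge0 ((A ^+ 0 *m B) i j)) step t.
move=> /le_trans -> //; rewrite ler_wpM2r ?exprn_ge0 ?(ltW s0) // lerD2r.
rewrite expr0 mul1mx /b (bigD1 i) //= (bigD1 j) //= -addrA lerDl.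
by rewrite addr_ge0 ?sumr_ge0 // => k _; apply: sumr_ge0.
Qed.

(* By Cayley-Hamilton it applies with s the eigenvalues of A and B = 1; each
   factor A - z is removed by a scalar recursion with multiplier z. *)
Lemma powers_decay_roots (s : seq F) (B : 'M[F]_n.+1) :
  (forall z, z \in s -> `|z| < 1) ->
  horner_mx A (\prod_(z <- s) ('X - z%:P)) *m B = 0 -> powers_decay B.
Proof.
elim: s B => [|z s IH] B s1.
  rewrite big_nil rmorph1 mul1mx => ->; exists 1, 2^-1.
  split=> // [|t i j]; first by rewrite invr_gt0 ltr0n invf_lt1 ?ltr1n.
  by rewrite mulmx0 mxE normr0 mul1r exprn_ge0 // invr_ge0.
rewrite big_cons mulrC rmorphM /= rmorphB /= horner_mx_X horner_mx_C.
rewrite -mulmxE -mulmxA => /IH H.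
apply: (@powers_decay_step _ z); first by rewrite s1 ?mem_head.
by apply: H => x xs; rewrite s1 // in_cons xs orbT.
Qed.

End PowersBound.

Section Schur.
Variable R : realType.

Lemma schur_powers n (A : 'M[R]_n.+1) : schur A -> exists c rho : R,
  [/\ 0 < c, 0 < rho < 1 & forall t i j, `|(A ^+ t) i j| <= c * rho ^+ t].
Proof.
move=> sA; pose Ac := map_mx (real_complex R) A.
have [s Ds] := closed_field_poly_normal (char_poly Ac).
have /monicP lead1 := char_poly_monic Ac.
rewrite lead1 scale1r in Ds.
have [||c [rho [c0 /andP[r0 r1] H]]] := @powers_decay_roots _ n Ac s 1%:M.
- move=> z zs; apply: sA; rewrite eigenvalue_root_char Ds.
  by rewrite root_prod_XsubC.
- by rewrite -Ds Cayley_Hamilton mul0mx.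
(* The constants obtained are complex, but positivity in the complex order forces a zero imaginary
   part, so their real parts serve over [R]. *)
have realE (x : R[i]) : 0 < x -> x = (complex.Re x)%:C%C.
  by move=> /gtr0_real /RRe_real.
have Ec := realE _ c0; have Er := realE _ r0.
rewrite Ec in c0 H; rewrite Er in r0 r1 H.
exists (complex.Re c), (complex.Re rho).
rewrite -!ltcR c0 r0 r1; split=> // t i j.
have := H t i j; rewrite mulmx1 -rmorphXn /= mxE.
rewrite normc_def /= expr0n /= addr0 sqrtr_sqr.
by rewrite -rmorphXn -rmorphM /= lecR.
Qed.

(** With the empty type ['I_0] of delays an undelayed system is an instance of [delay_system], so
    that [exp_stable_forced] applies to it. *)
Lemma schur_exp_stable n (A : 'M[R]_n) (M : 'I_0 -> 'M[R]_n) (rd : 'I_0 -> nat) :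
  schur A -> exp_stable 0 (delay_system A M rd).
Proof.
(* [schur_powers] covers positive sizes; in size 0 every vector is zero. *)
case: n A M => [A M _|n A M /schur_powers [c [rho [c0 r01 H]]]].
  exists 1, 2^-1; split=> // [|x _ t]; first by apply/andP; split; lra.
  rewrite flatmx0 normr0 mul1r mulr_ge0 ?exprn_ge0 ?invr_ge0 //.
  by apply: bigmax_ge_id.
have [r0 r1] := andP r01.
pose m : R := n.+1%:R; have m0 : 0 < m by rewrite ltr0n.
exists (m * c), rho; split; rewrite ?mulr_gt0 // => x sys t.
have xE : x t = A ^+ t *m x 0.
  elim: t => [|t IH]; first by rewrite expr0 mul1mx.
  by rewrite sys big_ord0 addr0 IH mulmxA mulmxE -exprS.
rewrite big_ord_recl big_ord0 /= maxEle oppr0.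
have -> : (if `|x 0| <= 0 then 0 else `|x 0|) = `|x 0|.
  by case: ifP => // ?; apply/esym/eqP; rewrite eq_le normr_ge0 andbT.
have cr0 : 0 <= c * rho ^+ t by rewrite mulr_ge0 ?exprn_ge0 ?(ltW c0) ?(ltW r0).
rewrite xE; apply: mx_norm_le => [|i j].
  by rewrite mulr_ge0 // -mulrA mulr_ge0 // ltW.
rewrite mxE (le_trans (ler_norm_sum _ _ _)) //.
apply: (@le_trans _ _ (\sum_(k < n.+1) c * rho ^+ t * `|x 0|)).
  by apply: ler_sum => k _; rewrite normrM ler_pM // mx_entry_le.
by rewrite sumr_const card_ord -mulr_natl !mulrA.
Qed.

End Schur.

(** * The distributed observer *)

Section Stacking.
Variables (R : realType) (N q : nat).

(** Entries are ordered by the index bijection of [*t], so that Kronecker products act on the agents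
    and on the coordinates separately. *)
Definition stack (v : 'I_N -> 'cV[R]_q) : 'cV[R]_(N * q) :=
  \col_k v (mxtens_unindex k).1 (mxtens_unindex k).2 0.

Lemma stack_tens (A : 'M[R]_N) (B : 'M[R]_q) (v : 'I_N -> 'cV[R]_q) :
  (A *t B) *m stack v = stack (fun i => \sum_j A i j *: (B *m v j)).
Proof.
apply/matrixP => k o; rewrite (ord1 o) {o} !mxE summxE.
rewrite (reindex (@mxtens_index N q)) /=; last first.
  by exists (@mxtens_unindex N q) => [?|?] _; rewrite ?mxtens_indexK ?mxtens_unindexK.
rewrite (eq_bigr (fun p => (fun i j => (A *t B) k (mxtens_index (i, j))
   * stack v (mxtens_index (i, j)) 0) p.1 p.2)) => [|[i j] _ //].
rewrite -(pair_bigA _ (fun i j => (A *t B) k (mxtens_index (i, j))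
   * stack v (mxtens_index (i, j)) 0)) /=.
apply: eq_bigr => i _; rewrite !mxE mulr_sumr; apply: eq_bigr => j _.
by rewrite !mxE mxtens_indexK /= mulrA.
Qed.

Lemma stack_norm_ge (v : 'I_N -> 'cV[R]_q) i : `|v i| <= `|stack v|.
Proof.
apply: mx_norm_le => // p o; rewrite (ord1 o).
have -> : v i p 0 = stack v (mxtens_index (i, p)) 0 by rewrite mxE mxtens_indexK.
exact: mx_entry_le.
Qed.

Lemma stack_norm (v : 'I_N -> 'cV[R]_q) : `|stack v| <= \sum_i `|v i|.
Proof.
apply: mx_norm_le => [|k o]; first exact: sumr_ge0.
rewrite mxE (le_trans (mx_entry_le _ _ _)) //.
by rewrite [leRHS](bigD1 (mxtens_unindex k).1) //= lerDl sumr_ge0.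
Qed.

End Stacking.

(** * The observer-based controller and its error equations *)

Section Controller.
Variables (R : realType) (N h q : nat) (rd : 'I_h.+1 -> nat) (S0 : 'M[R]_q).
Variables (P : 'I_N -> subsystem R h q) (E : rel 'I_N.+1) (a : 'M[R]_N.+1).
Variables (mu : R).
Variable K1 : forall i, 'M[R]_(dimu (P i), dimx (P i)).
Variable Kw : forall i, 'M[R]_(dimu (P i), dimw (P i)).
Variable K0 : forall i, 'M[R]_(dimu (P i), q).
Variable L : forall i, 'M[R]_(dimx (P i) + dimw (P i), dimm (P i)).
Hypothesis rd0 : rd ord0 = 0%N.
Hypothesis adj : weighted_adjacency E a.

Let Aw i := block_mx (Amx (P i)) (Ewmx (P i)) 0 (Qmx (P i)).
Let Cw i := row_mx (Cm (P i)) (Fwm (P i)).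

Definition controller_dim i : nat := (dimx (P i) + dimw (P i) + q)%N.

Definition feedback_gain i : 'M[R]_(dimu (P i), controller_dim i) :=
  row_mx (row_mx (K1 i) (Kw i)) (K0 i).

(** The subtracted term removes the contribution of the inputs to the measurement, so that they
    cancel from the estimation error. *)
Definition input_injection i l : 'M[R]_(dimx (P i) + dimw (P i), dimu (P i)) :=
  col_mx (Bmx (P i) l) 0 - L i *m Dm (P i) l.

Definition leader_injection i : 'M[R]_(dimx (P i) + dimw (P i), q) :=
  col_mx (Exmx (P i)) 0 - L i *m Fxm (P i).

(** [Hmx a i i] sums all weights at agent [i], the leader's included, so the lower right block
    gathers every occurrence of [eta_i] in its own observer equation. *)
Definition self_update i : 'M[R]_(controller_dim i) :=
  block_mx (Aw i - L i *m Cw i) (leader_injection i)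
    0 (S0 - (mu * Hmx a i i) *: S0).

(** A delayed input is the feedback gain applied to a delayed controller state, which the control
    law may use. *)
Definition input_gain i l : 'M[R]_(controller_dim i) :=
  col_mx (input_injection i l *m feedback_gain i) 0.

Definition measurement_gain i : 'M[R]_(controller_dim i, dimm (P i)) :=
  col_mx (L i) 0.

Definition leader_gain i : 'M[R]_(controller_dim i, q) :=
  col_mx 0 ((mu * a (node i) ord0) *: S0).

Definition neighbor_gain i j : 'M[R]_(controller_dim i, controller_dim j) :=
  block_mx 0 0 0 ((mu * a (node i) (node j)) *: S0).

(* The state of the controller of agent i stacks an estimate of (x_i, w_i) and
   an estimate eta_i of x_0.  conform_mx only serves to give the diagonal gains
   (j = i) the type required at an arbitrary j. *)
Definition observer_law : control_law P := @ControlLaw R N h q P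
  controller_dim
  feedback_gain
  (fun i j l =>
    (if j == i then
       conform_mx 0 (input_gain i l + (if l == ord0 then self_update i else 0))
     else 0)
    + (if l == ord0 then neighbor_gain i j else 0))
  (fun i j => if j == i then conform_mx 0 (measurement_gain i) else 0)
  leader_gain.

Section Trajectory.
Variables (x0 : int -> 'cV[R]_q) (w : forall i, nat -> 'cV[R]_(dimw (P i))).
Variable x : forall i, int -> 'cV[R]_(dimx (P i)).
Variable z : forall i, int -> 'cV[R]_(dimz observer_law i).

Definition plant_estimate i t : 'cV[R]_(dimx (P i) + dimw (P i)) :=
  @usubmx R (dimx (P i) + dimw (P i)) q 1 (z i t).
Definition leader_estimate i t : 'cV[R]_q :=
  @dsubmx R (dimx (P i) + dimw (P i)) q 1 (z i t).

Let u := input z.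

Lemma controller_stateE i t :
  z i t = col_mx (plant_estimate i t) (leader_estimate i t).
Proof. by rewrite [RHS]vsubmxK. Qed.

(** The restriction to neighbors disappears because the weights vanish off the edges and on the
    diagonal. *)
Lemma controller_nextE i (t : nat) : controller_next rd E x0 w x z i t =
  \sum_(l < h.+1) input_gain i l *m z i (t%:Z - (rd l)%:Z)
  + self_update i *m z i t
  + measurement_gain i *m measurement rd (x i) (u i) x0 (w i) t
  + \sum_j neighbor_gain i j *m z j t
  + leader_gain i *m x0 t.
Proof.
case: adj => diag edge; rewrite /controller_next; congr (_ + _); last first.
  case: ifP => // nE; have := edge (node i) ord0 isT; rewrite nE /= => ai0.
  by rewrite /leader_gain ai0 mulr0 scale0r col_mx0 mul0mx.
(* Undelayed gains are attached to the index [ord0], whose delay is 0. *)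
have pick_ord0 m n (B : 'M[R]_(m, n)) (y : int -> 'cV[R]_n) :
    \sum_(l < h.+1) (if l == ord0 then B else 0) *m y (t%:Z - (rd l)%:Z)
    = B *m y t.
  rewrite (bigD1 ord0) //= rd0 subr0 big1 ?addr0 // => l /negPf ->.
  exact: mul0mx.
have other j : j != i ->
    \sum_(l < h.+1) gz observer_law i j l *m z j (t%:Z - (rd l)%:Z)
      + gy observer_law i j *m measurement rd (x j) (u j) x0 (w j) t
    = neighbor_gain i j *m z j t.
  move=> /negPf ji /=; rewrite ji mul0mx addr0 -pick_ord0.
  by apply: eq_bigr => l _; rewrite add0r.
rewrite (bigD1 i) ?eqxx //=.
have -> : \sum_(j < N | ((j == i) || E (node j) (node i)) && (j != i))
   (\sum_(l < h.+1) gz observer_law i j l *m z j (t%:Z - (rd l)%:Z)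
      + gy observer_law i j *m measurement rd (x j) (u j) x0 (w j) t)
  = \sum_j neighbor_gain i j *m z j t.
  rewrite [LHS]big_mkcond; apply: eq_bigr => j _.
  have [->|ji] := eqVneq j i.
    by rewrite /neighbor_gain diag mulr0 scale0r block_mx0 andbF mul0mx.
  rewrite andbT /=; case: ifP => [_|nE]; first by rewrite other.
  have ne : node i != node j by rewrite (inj_eq (@lift_inj _ _)) eq_sym.
  have := edge (node i) (node j) ne; rewrite nE /= => aij.
  by rewrite /neighbor_gain aij mulr0 scale0r block_mx0 mul0mx.
congr (_ + _).
rewrite eqxx conform_mx_id -[self_update i *m _]pick_ord0 -big_split /=.
congr (_ + _); apply: eq_bigr => l _; rewrite -mulmxDl conform_mx_id.
congr (_ *m _); case: ifP => _; rewrite ?addr0 //.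
by rewrite /neighbor_gain diag mulr0 scale0r block_mx0 addr0.
Qed.

Hypothesis cl : closed_loop rd E x0 w x z.

Lemma plant_estimateS i (t : nat) : plant_estimate i t.+1 =
  (Aw i - L i *m Cw i) *m plant_estimate i t
  + leader_injection i *m leader_estimate i t
  + \sum_(l < h.+1) input_injection i l *m u i (t%:Z - (rd l)%:Z)
  + L i *m measurement rd (x i) (u i) x0 (w i) t.
Proof.
have [_ zS] := cl i; rewrite {1}/plant_estimate zS controller_nextE.
move: (measurement rd (x i) (u i) x0 (w i) t) => y.
rewrite !raddfD !raddf_sum /=.
rewrite [X in _ + _ + X + _]big1 => [|j _]; last first.
  by rewrite (controller_stateE j) mul_block_col !mul0mx addr0 col_mxKu.
rewrite !mul_col_mx !col_mxKu mul0mx !addr0 (controller_stateE i).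
rewrite mul_row_col [X in X + _](addrC) -!addrA; congr (_ + (_ + (_ + _))).
by apply: eq_bigr => l _; rewrite mul_col_mx col_mxKu mulmxA.
Qed.

Lemma leader_estimateS i (t : nat) : leader_estimate i t.+1 =
  S0 *m leader_estimate i t - (mu * Hmx a i i) *: (S0 *m leader_estimate i t)
  + \sum_j (mu * a (node i) (node j)) *: (S0 *m leader_estimate j t)
  + (mu * a (node i) ord0) *: (S0 *m x0 t).
Proof.
have [_ zS] := cl i; rewrite {1}/leader_estimate zS controller_nextE.
move: (measurement rd (x i) (u i) x0 (w i) t) => y.
rewrite !raddfD !raddf_sum /=.
rewrite [X in X + _ + _ + _ + _]big1 => [|l _]; last first.
  by rewrite mul_col_mx mul0mx col_mxKd.
rewrite !mul_col_mx !col_mxKd mul0mx !addr0 add0r (controller_stateE i).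
rewrite mul_row_col mul0mx add0r mulmxBl !scalemxAl; congr (_ + _ + _).
apply: eq_bigr => j _.
by rewrite (controller_stateE j) mul_block_col col_mxKd !mul0mx add0r scalemxAl.
Qed.

Hypothesis exo : exosystem S0 x0 w.

Definition leader_error i (t : int) : 'cV[R]_q := leader_estimate i t - x0 t.

Definition plant_error i (t : nat) : 'cV[R]_(dimx (P i) + dimw (P i)) :=
  plant_estimate i t - col_mx (x i t) (w i t).

(** Inputs and measurement corrections cancel; the only forcing left comes from using [eta_i] in
    place of [x0]. *)
Lemma plant_errorS i (t : nat) : plant_error i t.+1 =
  (Aw i - L i *m Cw i) *m plant_error i t
  + leader_injection i *m leader_error i t.
Proof.
have [xS _] := cl i; have [_ wS] := exo.
have xwS : col_mx (x i t.+1) (w i t.+1) = Aw i *m col_mx (x i t) (w i t)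
    + \sum_(l < h.+1) col_mx (Bmx (P i) l) 0 *m u i (t%:Z - (rd l)%:Z)
    + col_mx (Exmx (P i)) 0 *m x0 t.
  under eq_bigr => l _ do rewrite mul_col_mx mul0mx.
  have -> : \sum_(l < h.+1) col_mx (Bmx (P i) l *m u i (t%:Z - (rd l)%:Z))
        (0 : 'cV_(dimw (P i)))
      = col_mx (\sum_(l < h.+1) Bmx (P i) l *m u i (t%:Z - (rd l)%:Z)) 0.
    by rewrite -[LHS]vsubmxK !raddf_sum /=; congr col_mx;
      [apply: eq_bigr | rewrite big1] => // l _; rewrite ?col_mxKu ?col_mxKd.
  rewrite mul_block_col mul_col_mx !mul0mx add0r !add_col_mx !addr0 xS wS.
  by congr col_mx; rewrite -!addrA; congr (_ + _); rewrite [RHS]addrC -addrA.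
have mE : measurement rd (x i) (u i) x0 (w i) t = Cw i *m col_mx (x i t) (w i t)
    + \sum_(l < h.+1) Dm (P i) l *m u i (t%:Z - (rd l)%:Z) + Fxm (P i) *m x0 t.
  by rewrite mul_row_col /measurement addrAC; congr (_ + _); rewrite addrAC.
rewrite /plant_error plant_estimateS xwS mE /leader_error.
rewrite /leader_injection /input_injection.
under eq_bigr => l _ do rewrite mulmxBl -mulmxA.
rewrite sumrB -mulmx_sumr !(mulmxBl, mulmxBr, mulmxDr) -!mulmxA.
move: (\sum_(l < h.+1) col_mx _ _ *m _) (L i *m (\sum_l _)) => V LU.
move: (Aw i *m col_mx _ _) (L i *m (Cw i *m col_mx _ _)) => Ax LCx.
move: (Aw i *m _) (L i *m (Cw i *m _)) (L i *m (Fxm _ *m x0 _)) => Ap LCp LF0.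
move: (col_mx _ _ *m x0 _) (col_mx _ _ *m _) (L i *m _) => E0 El LFl.
by apply/matrixP => k l; rewrite !mxE; ring.
Qed.

Lemma leader_errorS i (t : nat) : leader_error i t.+1 =
  \sum_j (1%:M : 'M[R]_N) i j *: (S0 *m leader_error j t)
  - mu *: \sum_j Hmx a i j *: (S0 *m leader_error j t).
Proof.
have [diag _] := adj; have [x0S _] := exo.
(* Row [i] of [Hmx a] therefore sums to the leader weight, which is why the terms in [x0] combine
   into leader errors. *)
have HE : \sum_j a (node i) (node j) = Hmx a i i - a (node i) ord0.
  by rewrite mxE eqxx big_ord_recl addrAC subrr add0r.
have -> : \sum_j (1%:M : 'M[R]_N) i j *: (S0 *m leader_error j t)
    = S0 *m leader_error i t.
  rewrite (bigD1 i) //= mxE eqxx scale1r big1 ?addr0 // => j ji.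
  by rewrite mxE eq_sym (negPf ji) scale0r.
have -> : \sum_j Hmx a i j *: (S0 *m leader_error j t)
    = Hmx a i i *: (S0 *m leader_error i t)
      - \sum_j a (node i) (node j) *: (S0 *m leader_error j t).
  rewrite (bigD1 i) //= [X in _ - X](bigD1 i) //= diag scale0r add0r.
  congr (_ + _); rewrite -sumrN; apply: eq_bigr => j ji.
  by rewrite mxE eq_sym (negPf ji) scaleNr.
rewrite /leader_error leader_estimateS x0S.
under [X in _ = _ - _ *: (_ - X)]eq_bigr => j _ do rewrite mulmxBr scalerBr.
rewrite sumrB -scaler_suml HE.
under eq_bigr => j _ do rewrite -scalerA.
rewrite -scaler_sumr mulmxBr !scalerBr.
move: (\sum_j _) (S0 *m leader_estimate i t) (S0 *m x0 t) => Y Z W.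
by apply/matrixP => k l; rewrite !mxE; ring.
Qed.

Lemma leader_error_stackS (t : nat) : stack (leader_error^~ t.+1) =
  ((1%:M : 'M[R]_N) *t S0 - mu *: (Hmx a *t S0)) *m stack (leader_error^~ t).
Proof.
rewrite mulmxBl -scalemxAl !stack_tens.
by apply/matrixP => k l; rewrite mxE leader_errorS !mxE.
Qed.

(** Separation: the input is the full-information feedback plus a gain applied to the estimation
    errors. *)
Lemma inputE i (t : nat) : u i t =
  feedback_gain i *m col_mx (col_mx (x i t) (w i t)) (x0 t)
  + feedback_gain i *m col_mx (plant_error i t) (leader_error i t).
Proof.
rewrite -mulmxDr add_col_mx [plant_error _ _ in RHS]/plant_error /leader_error.
rewrite [col_mx (x i t) _ + _]addrC subrK [x0 t + _]addrC subrK.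
by rewrite -controller_stateE.
Qed.

End Trajectory.

(** * Decay of the estimation errors along closed-loop trajectories *)

Section Decay.
Variables (T : Type) (g : T -> R) (b : R).
Variables (x0 : T -> int -> 'cV[R]_q).
Variables (w : T -> forall i, nat -> 'cV[R]_(dimw (P i))).
Variables (x : T -> forall i, int -> 'cV[R]_(dimx (P i))).
Variables (z : T -> forall i, int -> 'cV[R]_(dimz observer_law i)).
Hypothesis g_ge0 : forall s, 0 <= g s.
Hypothesis b_gt0 : 0 < b.
Hypothesis exo : forall s, exosystem S0 (x0 s) (w s).
Hypothesis cl : forall s, closed_loop rd E (x0 s) (w s) (x s) (z s).
Hypothesis init_leader : forall s i, `|leader_error (x0 s) (z s) i 0| <= b * g s.
Hypothesis init_plant : forall s i,
  `|plant_error (w s) (x s) (z s) i 0| <= b * g s.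
Hypothesis observer_stable : exp_stable 0 (fun eta : int -> 'cV[R]_(N * q) =>
  forall t : nat,
    eta t.+1 = ((1%:M : 'M[R]_N) *t S0 - mu *: (Hmx a *t S0)) *m eta t).
Hypothesis L_schur : forall i, schur (Aw i - L i *m Cw i).

Lemma leader_error_decay i :
  exp_decay g (fun s t => `|leader_error (x0 s) (z s) i t|).
Proof.
pose Ob := (1%:M : 'M[R]_N) *t S0 - mu *: (Hmx a *t S0).
pose M (_ : 'I_0) : 'M[R]_(N * q) := 0; pose d (_ : 'I_0) := 0%N.
have stable : exp_stable 0 (delay_system Ob M d).
  case: observer_stable => c [rho [c0 r01 H]]; exists c, rho; split=> // y ys.
  by apply: H => t; rewrite ys big_ord0 addr0.
pose y s t := stack (leader_error (x0 s) (z s) ^~ t).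
(* The stacked norm is at most the sum of [N] norms, whence [N%:R * b]; adding 1 keeps the constant
   positive when [N = 0]. *)
apply: exp_decay_le (exp_stable_forced (x := y) (f := fun _ _ => 0)
  (b := N%:R * b + 1) stable g_ge0 _ _ _ _).
- by move=> s t; apply: (stack_norm_ge (leader_error (x0 s) (z s) ^~ t)).
- by rewrite ltr_wpDl // mulr_ge0 // ltW.
- by move=> s t; rewrite big_ord0 !addr0 /y (leader_error_stackS (cl s) (exo s)).
- move=> s k; rewrite leqn0 => /eqP ->; rewrite oppr0.
  apply: le_trans (stack_norm _) _.
  apply: (@le_trans _ _ (\sum_(j < N) b * g s)); first exact: ler_sum.
  by rewrite sumr_const card_ord mulrDl mul1r -mulrA mulr_natl lerDl.
- by apply: exp_decay_le (exp_decay_cst0 g_ge0) => s t; rewrite normr0.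
Qed.

Lemma plant_error_decay i :
  exp_decay g (fun s t => `|plant_error (w s) (x s) (z s) i t|).
Proof.
pose M (_ : 'I_0) : 'M[R]_(dimx (P i) + dimw (P i)) := 0.
pose d (_ : 'I_0) := 0%N.
(* The disturbance lives on [nat], so the error is extended to [int] by the absolute value; with no
   delay only nonnegative times are read. *)
pose y s (t : int) := plant_error (w s) (x s) (z s) i `|t|%N.
apply: exp_decay_le (exp_stable_forced (x := y) (schur_exp_stable M d (@L_schur i))
  g_ge0 b_gt0 (f := fun s t => leader_injection i *m leader_error (x0 s) (z s) i t) _ _ _).
- by [].
- by move=> s t; rewrite big_ord0 addr0 /y (plant_errorS (cl s) (exo s)).
- by move=> s k; rewrite leqn0 => /eqP ->; rewrite /y oppr0.
- exact/exp_decay_mulmx/leader_error_decay.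
Qed.

Lemma input_error_decay i : exp_decay g (fun s t =>
  `|input (z s) i t - feedback_gain i *m col_mx (col_mx (x s i t) (w s i t)) (x0 s t)|).
Proof.
have H : exp_decay g (fun s t => `|col_mx (plant_error (w s) (x s) (z s) i t)
    (leader_error (x0 s) (z s) i t)|).
  apply: exp_decay_le (exp_decayD g_ge0 (plant_error_decay i) (leader_error_decay i)).
  by move=> s t; exact: col_mx_norm.
apply: exp_decay_le (exp_decay_mulmx g_ge0 (feedback_gain i) H) => s t.
by rewrite (inputE (x0 s) (w s) (x s) (z s)) addrAC subrr add0r.
Qed.

End Decay.
End Controller.

(** * Stability and regulation *)

Section DelayedFeedback.
Variables (R : realType) (n m h r : nat) (rd : 'I_h -> nat).
Variables (A : 'M[R]_n) (B : 'I_h -> 'M[R]_(n, m)) (K : 'M[R]_(m, n)).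
Hypothesis rd_le : forall l, (rd l <= r)%N.
Hypothesis stable : exp_stable r (delay_system A (fun l => B l *m K) rd).
Variables (T : Type) (g : T -> R) (b : R).
Variables (x : T -> int -> 'cV[R]_n) (u : T -> int -> 'cV[R]_m).
Hypothesis g_ge0 : forall s, 0 <= g s.
Hypothesis b_gt0 : 0 < b.
Hypothesis xS : forall s (t : nat),
  x s t.+1 = A *m x s t + \sum_l B l *m u s (t%:Z - (rd l)%:Z).
Hypothesis x_init : forall s k, (k <= r)%N -> `|x s (- k%:Z)| <= b * g s.
Hypothesis u_init : forall s k, (k <= r)%N ->
  `|u s (- k%:Z) - K *m x s (- k%:Z)| <= b * g s.
Hypothesis u_decay : exp_decay g (fun s t => `|u s t - K *m x s t|).

(** Writing each delayed input as [K x + (u - K x)] gives the stable delayed closed loop, forced by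
    delayed values of the decaying [u - K x]. *)
Lemma feedback_state_decay : exp_decay g (fun s t => `|x s t|).
Proof.
apply: (exp_stable_forced stable g_ge0 b_gt0 (f := fun s t =>
  \sum_l B l *m (u s (t%:Z - (rd l)%:Z) - K *m x s (t%:Z - (rd l)%:Z)))) => //.
  move=> s t; rewrite xS -addrA -big_split /=; congr (_ + _).
  by apply: eq_bigr => l _; rewrite -mulmxA -mulmxDr [K *m _ + _]addrC subrK.
apply: (exp_decay_norm_sum g_ge0) => l; apply: (exp_decay_mulmx g_ge0).
exact: (exp_decay_history g_ge0 b_gt0 (f := fun s t => u s t - K *m x s t)
  u_init (rd_le l)).
Qed.

Lemma feedback_output_decay p (C : 'M[R]_(p, n)) (D : 'I_h -> 'M[R]_(p, m)) :
  exp_decay g (fun s t =>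
    `|C *m x s t + \sum_l D l *m u s (t%:Z - (rd l)%:Z)|).
Proof.
have xd := feedback_state_decay.
apply: (exp_decay_normD g_ge0); first exact: exp_decay_mulmx.
apply: (exp_decay_norm_sum g_ge0) => l; apply: (exp_decay_mulmx g_ge0).
have ud := exp_decay_history g_ge0 b_gt0 (f := fun s t => u s t - K *m x s t)
  u_init (rd_le l) u_decay.
have xdl := exp_decay_history g_ge0 b_gt0 x_init (rd_le l) xd.
have := exp_decay_normD g_ge0 ud (exp_decay_mulmx g_ge0 K xdl).
by apply: exp_decay_le => s t; rewrite subrK.
Qed.

End DelayedFeedback.

Lemma delays_le_max h (rd : 'I_h.+1 -> nat) l : delays rd -> (rd l <= rd ord_max)%N.
Proof.
move=> [_ mono]; have [->//|ne] := eqVneq l ord_max.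
apply/ltnW/mono; rewrite ltn_neqAle -ltnS ltn_ord andbT.
by apply: contra ne => /eqP e; apply/eqP/val_inj.
Qed.

(** * The regulator law: closed-loop stability and error regulation *)

Section Regulation.
Variables (R : realType) (N h q : nat) (rd : 'I_h.+1 -> nat) (S0 : 'M[R]_q).
Variables (P : 'I_N -> subsystem R h q) (E : rel 'I_N.+1) (a : 'M[R]_N.+1).
Variables (mu : R).
Variable K : forall i, 'M[R]_(dimu (P i), dimx (P i)).
Variable X : forall i, 'M[R]_(dimx (P i), q + dimw (P i)).
Variable U : forall i, 'M[R]_(dimu (P i), q + dimw (P i)).
Variable L : forall i, 'M[R]_(dimx (P i) + dimw (P i), dimm (P i)).
Hypothesis rd_delays : delays rd.
Hypothesis adj : weighted_adjacency E a.
Let r := rd ord_max.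
Let S i := block_mx S0 0 0 (Qmx (P i)).
Hypothesis K_stable : forall i, exp_stable r
  (delay_system (Amx (P i)) (fun l => Bmx (P i) l *m K i) rd).
Hypothesis regX : forall i, X i *m S i ^+ r.+1 = Amx (P i) *m X i *m S i ^+ r
  + \sum_(l < h.+1) Bmx (P i) l *m U i *m S i ^+ (r - rd l)
  + row_mx (Exmx (P i)) (Ewmx (P i)) *m S i ^+ r.
Hypothesis regE : forall i, 0 = Cmx (P i) *m X i *m S i ^+ r
  + \sum_(l < h.+1) Dmx (P i) l *m U i *m S i ^+ (r - rd l)
  + row_mx (Fxmx (P i)) (Fwmx (P i)) *m S i ^+ r.
Hypothesis observer_stable : exp_stable 0 (fun eta : int -> 'cV[R]_(N * q) =>
  forall t : nat,
    eta t.+1 = ((1%:M : 'M[R]_N) *t S0 - mu *: (Hmx a *t S0)) *m eta t).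
Hypothesis L_schur : forall i, schur
  (block_mx (Amx (P i)) (Ewmx (P i)) 0 (Qmx (P i))
   - L i *m row_mx (Cm (P i)) (Fwm (P i))).

(** The regulator equations order the exogenous signal as [(x0, w_i)], so the right block of the
    feedforward gain acts on the disturbance estimate and the left block on [eta_i]. *)
Definition regulator_law : control_law P :=
  observer_law S0 a mu K (fun i => rsubmx (U i - K i *m X i))
    (fun i => lsubmx (U i - K i *m X i)) L.

Let rd0 : rd ord0 = 0%N := proj1 rd_delays.
Let rd_le l : (rd l <= r)%N := delays_le_max l rd_delays.

(** The family [T] consists of all trajectories with zero exogenous signals, measured by the maximum
    over the initial window, so the uniform constants of [exp_decay] are those of exponential
    stability. *)
Lemma regulator_law_stable : closed_loop_exp_stable rd E regulator_law.
Proof.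
pose T := {xz : (forall i, int -> 'cV[R]_(dimx (P i))) *
    (forall i, int -> 'cV[R]_(dimz regulator_law i)) |
  closed_loop rd E (fun=> 0) (fun i => fun=> 0) xz.1 xz.2}.
pose x (s : T) := (proj1_sig s).1; pose z (s : T) := (proj1_sig s).2.
have cl s : closed_loop rd E (fun=> 0) (fun i => fun=> 0) (x s) (z s) := proj2_sig s.
pose g (s : T) : R :=
  \big[Num.max/0]_(k < r.+1) `|closed_loop_state (x s) (z s) (- k%:Z)|.
have g0 s : 0 <= g s by exact: bigmax_ge_id.
have stateg s k : (k <= r)%N -> `|closed_loop_state (x s) (z s) (- k%:Z)| <= g s.
  move=> kr; rewrite -ltnS in kr.
  exact: (le_bigmax _ (fun k : 'I_r.+1 => `|closed_loop_state (x s) (z s) (- k%:Z)|)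
    (Ordinal kr)).
have xg s i k : (k <= r)%N -> `|x s i (- k%:Z)| <= g s.
  move=> kr; apply: le_trans (stateg s k kr).
  have := usubmx_norm (closed_loop_state (x s) (z s) (- k%:Z)).
  by rewrite col_mxKu; apply: le_trans; apply: (mxcol_norm_ge (fun i => x s i (- k%:Z))).
have zg s i k : (k <= r)%N -> `|z s i (- k%:Z)| <= g s.
  move=> kr; apply: le_trans (stateg s k kr).
  have := dsubmx_norm (closed_loop_state (x s) (z s) (- k%:Z)).
  by rewrite col_mxKd; apply: le_trans; apply: (mxcol_norm_ge (fun i => z s i (- k%:Z))).
have exo (s : T) : exosystem S0 (fun=> 0) (fun (i : 'I_N) => fun=> 0 : 'cV[R]_(dimw (P i))).
  by split=> *; rewrite mulmx0.
have leader0 s i : `|leader_error (fun=> 0) (z s) i 0| <= 2 * g s.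
  rewrite /leader_error subr0.
  apply: le_trans (dsubmx_norm _) _; apply: le_trans (zg s i 0%N isT) _.
  by rewrite ler_peMl // ler1n.
(* The factor 2 arises since the error is a difference of an estimate and a state, each bounded by
   [g s]. *)
have plant0 s i : `|plant_error (fun i => fun=> 0) (x s) (z s) i 0| <= 2 * g s.
  rewrite /plant_error; apply: le_trans (ler_normB _ _) _.
  rewrite mulr_natl mulr2n; apply: lerD.
    by apply: le_trans (usubmx_norm _) (zg s i 0%N isT).
  by apply: le_trans (col_mx_norm _ _) _; rewrite normr0 addr0 (xg s i 0%N isT).
have b0 : 0 < 2 :> R by rewrite ltr0n.
have ld := leader_error_decay rd0 adj g0 b0 exo cl leader0 observer_stable.
have pd := plant_error_decay rd0 adj g0 b0 exo cl leader0 plant0 observer_stable L_schur.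
have id := input_error_decay rd0 adj g0 b0 exo cl leader0 plant0 observer_stable L_schur.
have xd i : exp_decay g (fun s t => `|x s i t|).
  (* The gain sums bound [u - K x] on the initial window for every agent; the added 1 makes [b]
     large enough for [x] itself. *)
  pose b := \sum_i (mx_abs_sum (kmx regulator_law i) + mx_abs_sum (K i)) + 1.
  have b_ge i' : mx_abs_sum (kmx regulator_law i') + mx_abs_sum (K i') <= b.
    rewrite /b (bigD1 i') //= -addrA lerDl addr_ge0 // sumr_ge0 // => j _.
    by rewrite addr_ge0 ?mx_abs_sum_ge0.
  have b1 : 1 <= b.
    by rewrite lerDr sumr_ge0 // => j _; rewrite addr_ge0 ?mx_abs_sum_ge0.
  apply: (feedback_state_decay (x := fun s => x s i) (u := fun s => input (z s) i) (b := b)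
    rd_le (K_stable i) g0).
  - exact: lt_le_trans b1.
  - by move=> s t; rewrite (proj1 (cl s i)) !mulmx0 !addr0.
  - by move=> s k kr; apply: le_trans (xg s i k kr) _; rewrite ler_peMl.
  - move=> s k kr; apply: le_trans (ler_normB _ _) _.
    apply: (@le_trans _ _ ((mx_abs_sum (kmx regulator_law i) + mx_abs_sum (K i)) * g s)).
      rewrite mulrDl; apply: lerD; apply: le_trans (mulmx_norm _ _) _.
        by rewrite ler_wpM2l ?mx_abs_sum_ge0 ?zg.
      by rewrite ler_wpM2l ?mx_abs_sum_ge0 ?xg.
    by rewrite ler_wpM2r.
  apply: exp_decay_le (id i) => s t.
  by rewrite !mul_row_col !mulmx0 !addr0.
(* The controller state is recovered from the two errors and [x], since here the leader and the
   disturbances are zero. *)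
have zd i : exp_decay g (fun s t => `|z s i t|).
  have := exp_decayD g0 (exp_decayD g0 (pd i) (xd i)) (ld i).
  apply: exp_decay_le => s t.
  rewrite (controller_stateE (z s)); apply: le_trans (col_mx_norm _ _) _.
  apply: lerD; last by rewrite /leader_error subr0.
  rewrite -[X in `|X|](subrK (col_mx (x s i t) 0)).
  apply: le_trans (ler_normD _ _) _; rewrite lerD2l.
  by apply: le_trans (col_mx_norm _ _) _; rewrite normr0 addr0.
have [c [rho [c0 r01 H]]] := exp_decayD g0 (exp_decay_sum g0 (index_enum _) xd)
  (exp_decay_sum g0 (index_enum _) zd).
exists c, rho; split=> // _ [x' [z' [cl' ->]]] t.
apply: le_trans (H (exist _ (x', z') cl') t).
apply: le_trans (col_mx_norm _ _) _; apply: lerD.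
  exact: (mxcol_norm (fun i => x' i t)).
exact: (mxcol_norm (fun i => z' i t)).
Qed.

Lemma regulator_law_error : error_regulation rd E regulator_law S0.
Proof.
move=> x0 w x z exo cl i.
(* A limit concerns one trajectory, so the family is a singleton and the initial data are absorbed
   into the constants [b]. *)
pose g (_ : unit) : R := 1; have g0 s : 0 <= g s by exact: ler01.
have id : exp_decay g (fun s t => `|input z i t
    - kmx regulator_law i *m col_mx (col_mx (x i t) (w i t)) (x0 t)|).
  pose b := \sum_i (`|leader_error x0 z i 0| + `|plant_error w x z i 0|) + 1.
  have b_ge j : `|leader_error x0 z j 0| + `|plant_error w x z j 0| <= b.
    by rewrite /b (bigD1 j) //= -addrA lerDl addr_ge0 ?sumr_ge0.
  have b0 : 0 < b by rewrite ltr_wpDl // sumr_ge0.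
  apply: (input_error_decay rd0 adj g0 b0 (fun=> exo) (fun=> cl) _ _
    observer_stable L_schur) => s j.
    by rewrite mulr1 (le_trans _ (b_ge j)) // lerDl.
  by rewrite mulr1 (le_trans _ (b_ge j)) // lerDr.
pose v k := col_mx (x0 (Posz k)) (w i k).
have vS s k : S i ^+ k *m v s = v (s + k)%N.
  elim: k => [|k IH]; first by rewrite expr0 mul1mx addn0.
  have [x0S wS] := exo.
  rewrite exprS -mulmxE -mulmxA IH addnS /v mul_block_col !mul0mx addr0 add0r.
  by rewrite x0S wS.
(* The shift by r keeps all delayed times nonnegative, where the exosystem
   equations hold. *)
pose xi (s : int) := x i (s + r%:Z) - X i *m v (absz (s + r%:Z)).
pose up (s : int) := input z i (s + r%:Z) - U i *m v (absz (s + r%:Z)).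
have xE (t : nat) : x i (t%:Z + r%:Z) = xi t + X i *m v (t + r)%N.
  by rewrite /xi -PoszD subrK.
(* Since [rd l <= r], the natural subtraction [r - rd l] is exact, and the exponents of the
   regulator equations match the shifted delayed times. *)
have uE (t : nat) l : input z i (t%:Z + r%:Z - (rd l)%:Z)
    = up (t%:Z - (rd l)%:Z) + U i *m v (t + (r - rd l))%N.
  have := rd_le l => rdl; rewrite /up addrAC.
  by rewrite (_ : absz _ = t + (r - rd l))%N ?subrK //; lia.
have sumE p (G : 'I_h.+1 -> 'M[R]_(p, dimu (P i))) (t : nat) :
    \sum_(l < h.+1) G l *m input z i ((t + r)%N%:Z - (rd l)%:Z)
    = \sum_l G l *m up (t%:Z - (rd l)%:Z)
      + (\sum_(l < h.+1) G l *m U i *m S i ^+ (r - rd l)) *m v t.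
  rewrite mulmx_suml -big_split; apply: eq_bigr => l _ /=.
  by rewrite PoszD uE mulmxDr -!mulmxA vS.
(* The regulator equation applied to [v t] is the plant equation at time [t + r] for [(X v, U v)];
   subtracting it removes all exogenous terms. *)
have xiS (t : nat) : xi t.+1 = Amx (P i) *m xi t
    + \sum_l Bmx (P i) l *m up (t%:Z - (rd l)%:Z).
  have := congr1 (mulmx^~ (v t)) (regX i).
  rewrite /= !mulmxDl -!mulmxA !vS mul_row_col addnS => e.
  have -> : xi t.+1 = x i (t + r)%N.+1 - X i *m v (t + r).+1.
    by rewrite /xi -PoszD.
  rewrite (proj1 (cl i)) sumE e PoszD xE mulmxDr.
  move: (mulmx (\sum_(l < h.+1) _) _) (\sum_l _) => s1 s2.
  move: (Exmx (P i) *m _) (Ewmx _ *m _) (Amx _ *m xi _) (Amx _ *m (X i *m _)) => e1 e2 e3 e4.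
  by apply/matrixP => j k; rewrite !mxE; ring.
have errE (t : nat) : error_output rd (x i) (input z i) x0 (w i) (t + r)%N
    = Cmx (P i) *m xi t + \sum_l Dmx (P i) l *m up (t%:Z - (rd l)%:Z).
  have := congr1 (mulmx^~ (v t)) (regE i).
  rewrite /= !mulmxDl -!mulmxA !vS mul_row_col mul0mx => e.
  rewrite /error_output sumE PoszD xE mulmxDr.
  rewrite -[RHS]addr0 [X in _ = _ + X]e.
  move: (mulmx (\sum_(l < h.+1) _) _) (\sum_l _) => s1 s2.
  move: (Fxmx (P i) *m _) (Fwmx _ *m _) (Cmx _ *m xi _) (Cmx _ *m (X i *m _)) => e1 e2 e3 e4.
  by apply/matrixP => j k; rewrite !mxE; ring.
pose F (k : nat) := `|xi (- k%:Z)| + `|up (- k%:Z) - K i *m xi (- k%:Z)|.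
have F0 k : 0 <= F k by rewrite addr_ge0.
pose b := \sum_(k < r.+1) F k + 1.
have b0 : 0 < b by rewrite ltr_wpDl // sumr_ge0.
have b_ge k : (k <= r)%N -> F k <= b.
  move=> kr; rewrite -ltnS in kr.
  by rewrite /b (bigD1 (Ordinal kr)) //= -addrA lerDl addr_ge0 ?sumr_ge0.
(* The feedforward gain [U - K X] is exactly what turns the deviation from full-information feedback
   into [up - K xi]. *)
have ud : exp_decay g (fun s t => `|up t - K i *m xi t|).
  apply: exp_decay_le (exp_decay_shift g0 r id) => s t.
  rewrite /up /xi -PoszD /= mul_row_col mul_row_col.
  have -> : K i *m x i (t + r)%N
    + rsubmx (U i - K i *m X i) *m w i (t + r)%N
    + lsubmx (U i - K i *m X i) *m x0 (t + r)%N
    = K i *m x i (t + r)%N + (U i - K i *m X i) *m v (t + r)%N.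
    by rewrite -[in RHS](hsubmxK (U i - _)) mul_row_col -addrA [X in _ + X = _]addrC.
  rewrite mulmxBr mulmxBl mulmxA le_eqVlt; apply/orP; left; apply/eqP; congr `|_|.
  move: (input z i _) (_ *m v _) (_ *m v _) (K i *m x i _) => e1 e2 e3 e4.
  by apply/matrixP => j k; rewrite !mxE; ring.
have := feedback_output_decay (x := fun=> xi) (u := fun=> up) rd_le (K_stable i)
  g0 b0 (fun=> xiS) _ _ ud (Cmx (P i)) (Dmx (P i)).
have H1 (s : unit) k : (k <= r)%N -> `|xi (- k%:Z)| <= b * g s.
  by move=> kr; rewrite mulr1 (le_trans _ (b_ge k kr)) // lerDl.
have H2 (s : unit) k : (k <= r)%N -> `|up (- k%:Z) - K i *m xi (- k%:Z)| <= b * g s.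
  by move=> kr; rewrite mulr1 (le_trans _ (b_ge k kr)) // lerDr.
move=> /(_ H1 H2) /(exp_decay_cvg0 (x := tt)) c0.
apply/norm_cvg0P; rewrite -(cvg_shiftn r).
have := c0 (fun=> normr_ge0 _).
by apply: cvg_trans; apply: near_eq_cvg; apply: nearW => t /=; rewrite errE.
Qed.

End Regulation.

Theorem theorem4p1 (R : realType) (N h q : nat) (rd : 'I_h.+1 -> nat)
    (S0 : 'M[R]_q) (P : 'I_N -> subsystem R h q)
    (E : rel 'I_N.+1) (a : 'M[R]_N.+1)
    (h_delays : delays rd)
    (h_adj : weighted_adjacency E a)
    (h_stab : forall i, stabilizable_by_delayed_feedback rd (P i))
    (h_det : forall i,
       detectable (block_mx (Amx (P i)) (Ewmx (P i)) 0 (Qmx (P i)))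
                  (row_mx (Cm (P i)) (Fwm (P i))))
    (h_reg : forall i, regulator_solvable rd S0 (P i))
    (h_reach : forall i : 'I_N, connect E ord0 (node i))
    (h_obs : exists mu : R,
       exp_stable 0 (fun eta : int -> 'cV[R]_(N * q) =>
         forall t : nat,
           eta t.+1 = ((1%:M : 'M[R]_N) *t S0 - mu *: (Hmx a *t S0)) *m eta t)) :
  cooperative_output_regulation_solvable rd E S0 P.
Proof.
have [mu obs] := h_obs.
(* The assumptions hold agent by agent; choice turns them into families of gains. *)
pose K i := projT1 (cid (h_stab i)).
have Kst i := projT2 (cid (h_stab i)).
pose L i := projT1 (cid (h_det i)).
have Lsch i := projT2 (cid (h_det i)).
pose X i := projT1 (cid (h_reg i)).
pose U i := projT1 (cid (projT2 (cid (h_reg i)))).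
have HU i := projT2 (cid (projT2 (cid (h_reg i)))).
exists (regulator_law S0 a mu K X U L); split.
  exact: regulator_law_stable.
apply: regulator_law_error => //.
  exact: (fun i => proj1 (HU i)).
exact: (fun i => proj2 (HU i)).
Qed.
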